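(* Let $\mathbf{A}\in\mathbb{R}^{d\times d}$ be invertible, let $\mathbf{b}\in\mathbb{R}^d$, and let $(\widetilde{\mu}^{(n)}_e,\widetilde{\Lambda}^{(n)}_e)_{e\in\mathcal{E}}$, $n\ge 0$, be messages generated by the GaBP update rules for $(\mathbf{A},\mathbf{b})$, with associated approximate solutions $\mu_i^{(n)}$ (all defined in the context; all denominators occurring in the rules are nonzero). If there is $N\in\mathbb{N}$ such that $\widetilde{\mu}^{(N+k)}_{e}=\widetilde{\mu}^{(N)}_{e}$ and $\widetilde{\Lambda}^{(N+k)}_{e}=\widetilde{\Lambda}^{(N)}_{e}$ for all $e\in\mathcal{E}$ and all $k\in\mathbb{N}$, then $\mu^{(N+k)}_i=\mu^{(N)}_i=\left(\mathbf{A}^{-1}\mathbf{b}\right)_i$ for all $i\in\{1,\dots,d\}$ and all $k\in\mathbb{N}$.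
   Context: The matrix $\mathbf{A}$ is not assumed symmetric. Its directed graph has vertex set $\mathcal{V}=\{1,\dots,d\}$ and, for $i\ne j$, a directed edge $e_{ji}=(j,i)\in\mathcal{E}$ from $j$ to $i$ if and only if $A_{ij}\neq 0$. $N(j)$ denotes the set of neighbours $k\neq j$ of $j$ that send messages to $j$, i.e. those $k$ with $(k,j)\in\mathcal{E}$ (equivalently $A_{jk}\ne0$). A message attached to a pair that is not an edge is by convention zero. Each edge $(j,i)\in\mathcal{E}$ carries two real messages $\widetilde{\Lambda}_{ji}^{(n)}$ and $\widetilde{\mu}_{ji}^{(n)}$ at step $n$. GaBP update rules: for every $(j,i)\in\mathcal{E}$ and $n\ge 0$, $$\widetilde{\Lambda}_{ji}^{(n+1)}=-\frac{A_{ij}}{A_{jj}+\sum_{k\in N(j)\setminus\{i\}}\widetilde{\Lambda}_{kj}^{(n)}A_{kj}},\qquad \widetilde{\mu}_{ji}^{(n+1)}=\widetilde{\Lambda}_{ji}^{(n+1)}\Big(b_j+\sum_{k\in N(j)\setminus\{i\}}\widetilde{\mu}_{kj}^{(n)}\Big).$$ Approximate solution at step $n$: $$\mu_i^{(n)}=\frac{b_i+\sum_{j\in N(i)}\widetilde{\mu}_{ji}^{(n)}}{A_{ii}+\sum_{j\in N(i)}\widetilde{\Lambda}_{ji}^{(n)}A_{ji}}.$$ *)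

(* Defs.v *)
From HB Require Import structures.
From mathcomp Require Import all_boot all_order all_algebra.
From mathcomp Require Import reals.

Set Implicit Arguments.
Unset Strict Implicit.
Unset Printing Implicit Defensive.

Import GRing.Theory.
Local Open Scope ring_scope.

(* Note the transposition: the edge j -> i is governed by the entry A i j. *)
Definition edges (R : realType) (d : nat) (A : 'M[R]_d) : {set 'I_d * 'I_d} :=
  [set e | (e.1 != e.2) && (A e.2 e.1 != 0)].

Definition nbr (R : realType) (d : nat) (A : 'M[R]_d) (j : 'I_d) : {set 'I_d} :=
  [set k | (k, j) \in edges A].

(* A family of messages is a function of the step and of the source and target
   vertices: [Lam n j i] is the message sent from j to i at step n. *)
Definition messages (R : realType) (d : nat) := nat -> 'I_d -> 'I_d -> R.

Definition zero_off_edges (R : realType) (d : nat) (A : 'M[R]_d)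
    (m : messages R d) : Prop :=
  forall n j i, (j, i) \notin edges A -> m n j i = 0.

Definition update_den (R : realType) (d : nat) (A : 'M[R]_d)
    (Lam : messages R d) (n : nat) (j i : 'I_d) : R :=
  A j j + \sum_(k in nbr A j :\ i) Lam n k j * A k j.

Definition approx_den (R : realType) (d : nat) (A : 'M[R]_d)
    (Lam : messages R d) (n : nat) (i : 'I_d) : R :=
  A i i + \sum_(j in nbr A i) Lam n j i * A j i.

(* Division by zero is total here, so the nonvanishing of the denominators is
   a separate condition. *)
Definition nonzero_dens (R : realType) (d : nat) (A : 'M[R]_d)
    (Lam : messages R d) : Prop :=
  (forall n j i, (j, i) \in edges A -> update_den A Lam n j i != 0) /\
  (forall n i, approx_den A Lam n i != 0).

Definition gabp_updates (R : realType) (d : nat) (A : 'M[R]_d) (b : 'cV[R]_d)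
    (Lam mu : messages R d) : Prop :=
  forall n j i, (j, i) \in edges A ->
    Lam n.+1 j i = - (A i j / update_den A Lam n j i) /\
    mu n.+1 j i =
      Lam n.+1 j i * (b j 0 + \sum_(k in nbr A j :\ i) mu n k j).

Definition approx_sol (R : realType) (d : nat) (A : 'M[R]_d) (b : 'cV[R]_d)
    (Lam mu : messages R d) (n : nat) (i : 'I_d) : R :=
  (b i 0 + \sum_(j in nbr A i) mu n j i) / approx_den A Lam n i.

(* Main.v *)
Require Import Defs.
From HB Require Import structures.
From mathcomp Require Import all_boot all_order all_algebra.
From mathcomp Require Import reals.
From mathcomp Require Import ring.

Set Implicit Arguments.
Unset Strict Implicit.
Unset Printing Implicit Defensive.

Import GRing.Theory.
Local Open Scope ring_scope.

(** Write [x] for the approximate solution, and [L], [m] for the messages, at a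
    step which the update rules leave unchanged.  The numerator and denominator
    of [x j] differ from those in the update of the message [j -> i] only by
    the message [i -> j], so [x j] can be eliminated from the update rules
    edge by edge.  What comes out is a relation
    [r j i = - L j i * r i j] (lemma [residual_swap]) for the residual
    [r j i = m j i + A i j * x j - L j i * A j i * x i].
    Applying it to both directions of an edge gives
    [(1 - L j i * L i j) * r j i = 0], and the factor is nonzero because
    [A i j * (1 - L j i * L i j) = - L j i * D j] with [D j] the denominator of
    [x j] (lemma [Lam_product_neq1]).  Hence all residuals vanish, that is
    [m j i = L j i * A j i * x i - A i j * x j]; substituting this in
    [D i * x i = b i + \sum_j m j i] cancels the terms in [L] and leaves row [i]
    of [A x = b].  When only one of [j -> i] and [i -> j] is an edge, the
    convention that messages vanish off the edges makes the same relations
    hold. *)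

Lemma in_nbr (R : realType) (d : nat) (A : 'M[R]_d) (j k : 'I_d) :
  (k \in nbr A j) = ((k, j) \in edges A).
Proof. by rewrite inE. Qed.

Lemma off_edge_entry0 (R : realType) (d : nat) (A : 'M[R]_d) (j i : 'I_d) :
  j != i -> (j, i) \notin edges A -> A i j = 0.
Proof. by move=> ji; rewrite inE /= ji /= negbK => /eqP. Qed.

Lemma sum_nbrD1 (R : realType) (d : nat) (A : 'M[R]_d) (j i : 'I_d)
    (f : 'I_d -> R) (f_off : (i, j) \notin edges A -> f i = 0) :
  \sum_(k in nbr A j :\ i) f k = \sum_(k in nbr A j) f k - f i.
Proof.
have [ij|ij] := boolP (i \in nbr A j).
  by rewrite [in RHS](big_setD1 i ij) /=; ring.
rewrite f_off ?subr0; last by rewrite -in_nbr.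
apply: eq_bigl => k; rewrite in_setD1.
by have [->|//] := eqVneq k i; rewrite (negbTE ij).
Qed.

Lemma mulmx_row_nbr (R : realType) (d : nat) (A : 'M[R]_d) (x : 'cV[R]_d)
    (i : 'I_d) :
  (A *m x) i 0 = A i i * x i 0 + \sum_(j in nbr A i) A i j * x j 0.
Proof.
rewrite mxE (bigD1 i) //=; congr (_ + _).
rewrite (bigID (mem (nbr A i))) /= [X in _ + X]big1 ?addr0.
  apply: eq_bigl => j; rewrite in_nbr !inE /=.
  by case: (j != i).
move=> j /andP[ji]; rewrite in_nbr => /(off_edge_entry0 ji) ->.
by rewrite mul0r.
Qed.

Definition fixed_at (R : realType) (d : nat) (A : 'M[R]_d)
    (m : messages R d) (n : nat) : Prop :=
  forall j i, (j, i) \in edges A -> m n.+1 j i = m n j i.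

Lemma update_denE (R : realType) (d : nat) (A : 'M[R]_d) (Lam : messages R d)
    (n : nat) (j i : 'I_d) (Lam_off : zero_off_edges A Lam) :
  update_den A Lam n j i = approx_den A Lam n j - Lam n i j * A i j.
Proof.
rewrite /update_den sum_nbrD1 ?addrA // => /(Lam_off n) ->.
by rewrite mul0r.
Qed.

Lemma fixed_LamE (R : realType) (d : nat) (A : 'M[R]_d) (b : 'cV[R]_d)
    (Lam mu : messages R d) (n : nat) (j i : 'I_d)
    (Lam_off : zero_off_edges A Lam) (dens : nonzero_dens A Lam)
    (updates : gabp_updates A b Lam mu) (Lam_fixed : fixed_at A Lam n)
    (ji : (j, i) \in edges A) :
  Lam n j i * (approx_den A Lam n j - Lam n i j * A i j) = - A i j.
Proof.
have [+ _] := updates n j i ji; rewrite Lam_fixed // => ->.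
by rewrite -update_denE // mulNr divfK //; apply: dens.1.
Qed.

Lemma approx_solK (R : realType) (d : nat) (A : 'M[R]_d) (b : 'cV[R]_d)
    (Lam mu : messages R d) (n : nat) (i : 'I_d) (dens : nonzero_dens A Lam) :
  approx_sol A b Lam mu n i * approx_den A Lam n i =
    b i 0 + \sum_(j in nbr A i) mu n j i.
Proof. by rewrite divfK //; apply: dens.2. Qed.

Lemma fixed_muE (R : realType) (d : nat) (A : 'M[R]_d) (b : 'cV[R]_d)
    (Lam mu : messages R d) (n : nat) (j i : 'I_d)
    (mu_off : zero_off_edges A mu) (dens : nonzero_dens A Lam)
    (updates : gabp_updates A b Lam mu)
    (Lam_fixed : fixed_at A Lam n) (mu_fixed : fixed_at A mu n)
    (ji : (j, i) \in edges A) :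
  mu n j i = Lam n j i *
    (approx_sol A b Lam mu n j * approx_den A Lam n j - mu n i j).
Proof.
have [_] := updates n j i ji; rewrite Lam_fixed // mu_fixed // => ->.
by rewrite approx_solK // sum_nbrD1 ?addrA //; apply: mu_off.
Qed.

(** By the fixed-point equation,
    [A i j * (1 - Lam j i * Lam i j) = - Lam j i * D j]; if the left side were
    zero, so would be [Lam j i], and then [A i j], on an edge. *)
Lemma Lam_product_neq1 (R : realType) (d : nat) (A : 'M[R]_d) (b : 'cV[R]_d)
    (Lam mu : messages R d) (n : nat) (j i : 'I_d)
    (Lam_off : zero_off_edges A Lam) (dens : nonzero_dens A Lam)
    (updates : gabp_updates A b Lam mu) (Lam_fixed : fixed_at A Lam n) :
  1 - Lam n j i * Lam n i j != 0.
Proof.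
have [ji|/(Lam_off n) ->] := boolP ((j, i) \in edges A); last first.
  by rewrite mul0r subr0 oner_eq0.
have fixE := fixed_LamE Lam_off dens updates Lam_fixed ji.
have Aij : A i j != 0 by move: ji; rewrite inE => /andP[].
apply/eqP => prod1; move/eqP: Aij; apply.
have LD0 : Lam n j i * approx_den A Lam n j = 0.
  transitivity (Lam n j i * (approx_den A Lam n j - Lam n i j * A i j)
      + A i j - A i j * (1 - Lam n j i * Lam n i j)); first by ring.
  by rewrite fixE prod1; ring.
move/eqP: LD0; rewrite mulf_eq0 (negbTE (dens.2 n j)) orbF => /eqP L0.
by apply/eqP; rewrite -oppr_eq0 -fixE L0 mul0r.
Qed.

(** The defect in the expected closed form
    [mu j i = Lam j i * A j i * x i - A i j * x j] of a stationary message. *)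
Definition residual (R : realType) (d : nat) (A : 'M[R]_d) (b : 'cV[R]_d)
    (Lam mu : messages R d) (n : nat) (j i : 'I_d) : R :=
  mu n j i + A i j * approx_sol A b Lam mu n j
    - Lam n j i * A j i * approx_sol A b Lam mu n i.

(** On an edge this is the update rule of [mu] with [Lam j i * D j] replaced by
    its value from the update rule of [Lam]; off the edges both sides vanish. *)
Lemma residual_swap (R : realType) (d : nat) (A : 'M[R]_d) (b : 'cV[R]_d)
    (Lam mu : messages R d) (n : nat) (j i : 'I_d)
    (Lam_off : zero_off_edges A Lam) (mu_off : zero_off_edges A mu)
    (dens : nonzero_dens A Lam) (updates : gabp_updates A b Lam mu)
    (Lam_fixed : fixed_at A Lam n) (mu_fixed : fixed_at A mu n)
    (ji_neq : j != i) :
  residual A b Lam mu n j i = - (Lam n j i * residual A b Lam mu n i j).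
Proof.
have [ji|ji] := boolP ((j, i) \in edges A); last first.
  rewrite /residual Lam_off // mu_off // off_edge_entry0 //.
  by ring.
have fixL := fixed_LamE Lam_off dens updates Lam_fixed ji.
have fixm := fixed_muE mu_off dens updates Lam_fixed mu_fixed ji.
rewrite {1}/residual fixm -[A i j in LHS]opprK -fixL /residual.
by ring.
Qed.

Lemma residual_eq0 (R : realType) (d : nat) (A : 'M[R]_d) (b : 'cV[R]_d)
    (Lam mu : messages R d) (n : nat) (j i : 'I_d)
    (Lam_off : zero_off_edges A Lam) (mu_off : zero_off_edges A mu)
    (dens : nonzero_dens A Lam) (updates : gabp_updates A b Lam mu)
    (Lam_fixed : fixed_at A Lam n) (mu_fixed : fixed_at A mu n)
    (ji_neq : j != i) :
  residual A b Lam mu n j i = 0.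
Proof.
have rji : residual A b Lam mu n j i =
    - (Lam n j i * residual A b Lam mu n i j) by exact: residual_swap.
have rij : residual A b Lam mu n i j =
    - (Lam n i j * residual A b Lam mu n j i).
  by apply: residual_swap => //; rewrite eq_sym.
apply: (mulfI (Lam_product_neq1 j i Lam_off dens updates Lam_fixed)).
rewrite mulr0 mulrBl mul1r {1}rji rij.
by ring.
Qed.

Lemma approx_sol_solves (R : realType) (d : nat) (A : 'M[R]_d) (b : 'cV[R]_d)
    (Lam mu : messages R d) (n : nat)
    (Lam_off : zero_off_edges A Lam) (mu_off : zero_off_edges A mu)
    (dens : nonzero_dens A Lam) (updates : gabp_updates A b Lam mu)
    (Lam_fixed : fixed_at A Lam n) (mu_fixed : fixed_at A mu n) :
  A *m (\col_i approx_sol A b Lam mu n i) = b.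
Proof.
apply/colP => i; rewrite mulmx_row_nbr mxE.
set x := approx_sol A b Lam mu n.
have muE j : j \in nbr A i ->
    mu n j i = Lam n j i * A j i * x i - A i j * x j.
  rewrite in_nbr inE => /andP[/= ij _].
  have := residual_eq0 Lam_off mu_off dens updates Lam_fixed mu_fixed ij.
  rewrite /residual -/x => /eqP; rewrite subr_eq0 => /eqP <-.
  by ring.
have := approx_solK b mu n i dens.
rewrite (eq_bigr _ muE) sumrB -mulr_suml -/x /approx_den => xD.
rewrite (eq_bigr (fun j => A i j * x j)) => [|j _]; last by rewrite mxE.
rewrite -[RHS](addrK (\sum_(j in nbr A i) Lam n j i * A j i * x i
  - \sum_(j in nbr A i) A i j * x j)) -mulr_suml -xD.
by ring.
Qed.

Theorem mainTheorem1 (R : realType) (d : nat) (A : 'M[R]_d) (b : 'cV[R]_d)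
    (Lam mu : messages R d) (N : nat)
    (A_unit : A \in unitmx)
    (Lam_off : zero_off_edges A Lam)
    (mu_off : zero_off_edges A mu)
    (dens : nonzero_dens A Lam)
    (updates : gabp_updates A b Lam mu)
    (stationary : forall (j i : 'I_d) (k : nat), (j, i) \in edges A ->
       mu (N + k)%N j i = mu N j i /\ Lam (N + k)%N j i = Lam N j i) :
  forall (i : 'I_d) (k : nat),
    approx_sol A b Lam mu (N + k)%N i = approx_sol A b Lam mu N i /\
    approx_sol A b Lam mu N i = (invmx A *m b) i 0.
Proof.
move=> i k; split.
  rewrite /approx_sol /approx_den; congr ((_ + _) / (_ + _)).
    by apply: eq_bigr => j; rewrite in_nbr => /(stationary _ _ k)[].
  by apply: eq_bigr => j; rewrite in_nbr => /(stationary _ _ k)[_ ->].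
have Lam_fixed : fixed_at A Lam N.
  by move=> j l /(stationary _ _ 1%N)[_]; rewrite addn1.
have mu_fixed : fixed_at A mu N.
  by move=> j l /(stationary _ _ 1%N)[]; rewrite addn1.
have Axb := approx_sol_solves Lam_off mu_off dens updates Lam_fixed mu_fixed.
by rewrite -[in RHS]Axb mulKmx // mxE.
Qed.
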